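(* Let $V$ be a Harish-Chandra module of $\widetilde{L}$ of nonzero level, i.e. $K_i$ acts on $V$ as a scalar $c_i\in\mathbb{C}$ ($i=1,2,3,4$) with $(c_1,c_2,c_3,c_4)\neq\mathbf{0}$. Then $V$ is a generalized highest weight (GHW) module.
   Context: All vector spaces are over $\mathbb{C}$; $\mathbb{Z}_+$ is the set of nonnegative integers. Let $\Gamma=\mathbb{Z}\mathbf{e}_1+\mathbb{Z}\mathbf{e}_2=\mathbb{Z}^2$ with $\mathbf{e}_1=(1,0)$, $\mathbf{e}_2=(0,1)$. For $\mathbf{a}=(a_1,a_2),\mathbf{b}=(b_1,b_2)\in\Gamma$ put $\det\binom{\mathbf{a}}{\mathbf{b}}=a_1b_2-a_2b_1$. $L$ is the Lie algebra with basis $\{t^{\mathbf{m}},E(\mathbf{m}),K_1,K_2,K_3,K_4\mid \mathbf{m}\in\Gamma\setminus\{\mathbf{0}\}\}$ and brackets: $K_i$ central; $[t^{\mathbf{m}},t^{\mathbf{n}}]=0$; $[t^{\mathbf{m}},E(\mathbf{n})]=\det\binom{\mathbf{n}}{\mathbf{m}}t^{\mathbf{m}+\mathbf{n}}+\delta_{\mathbf{m}+\mathbf{n},\mathbf{0}}h(\mathbf{m})$; $[E(\mathbf{m}),E(\mathbf{n})]=\det\binom{\mathbf{n}}{\mathbf{m}}E(\mathbf{m}+\mathbf{n})+\delta_{\mathbf{m}+\mathbf{n},\mathbf{0}}f(\mathbf{m})$, where $h(\mathbf{m})=m_1K_1+m_2K_2$, $f(\mathbf{m})=m_1K_3+m_2K_4$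 for $\mathbf{m}=(m_1,m_2)$, with the convention $E(\mathbf{0})=t^{\mathbf{0}}=0$. $\widetilde{L}=L\oplus\mathbb{C}d_1\oplus\mathbb{C}d_2$ with $[d_i,E(\mathbf{m})]=m_iE(\mathbf{m})$, $[d_i,t^{\mathbf{m}}]=m_it^{\mathbf{m}}$, $[d_i,K_j]=0$, $[d_1,d_2]=0$. A weight module of $\widetilde{L}$ is a module $V=\bigoplus_{\boldsymbol\lambda\in\mathbb{C}^6}V_{\boldsymbol\lambda}$ with $V_{\boldsymbol\lambda}=\{v\mid d_iv=\lambda_iv,\ K_jv=\lambda_{j+2}v,\ i=1,2,\ j=1,\dots,4\}$. A Harish-Chandra module is an irreducible weight module all of whose weight spaces are finite dimensional. On an irreducible weight module the $K_i$ act as scalars $c_i$, and $(c_1,c_2,c_3,c_4)$ is called its level. A weight module $V$ is a generalized highest weight (GHW) module if there are a $\mathbb{Z}$-basis $\{\mathbf{b}_1,\mathbf{b}_2\}$ of $\Gamma$ and a nonzero weight vector $v$ with $V=\mathcal{U}(\widetilde{L})v$ and $E(\mathbf{m})v=t^{\mathbf{m}}v=0$ for all $\mathbf{m}\in\mathbb{Z}_+\mathbf{b}_1+\mathbb{Z}_+\mathbf{b}_2$. *)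

(* Defs.v *)
From HB Require Import structures.
From mathcomp Require Import all_boot all_order all_algebra.
From mathcomp Require Import complex reals.
From mathcomp Require Import ring.
From mathcomp Require Import finmap monalg.

Set Implicit Arguments.
Unset Strict Implicit.
Unset Printing Implicit Defensive.

Import GRing.Theory Num.Theory.
Local Open Scope ring_scope.

Section LieModules.
Variables (F : fieldType) (L : lmodType F) (br : L -> L -> L).

Record is_lie_bracket : Prop := IsLieBracket {
  lieDl : forall a x y z, br (a *: x + y) z = a *: br x z + br y z;
  lieDr : forall a x y z, br x (a *: y + z) = a *: br x y + br x z;
  lie_alt : forall x, br x x = 0;
  lie_jacobi : forall x y z, br x (br y z) + br y (br z x) + br z (br x y) = 0
}.

Variables (V : lmodType F) (act : L -> V -> V).

Record is_lie_module : Prop := IsLieModule {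
  actDl : forall a x y v, act (a *: x + y) v = a *: act x v + act y v;
  actDr : forall a x v w, act x (a *: v + w) = a *: act x v + act x w;
  act_br : forall x y v, act (br x y) v = act x (act y v) - act y (act x v)
}.

Record is_submodule (W : V -> Prop) : Prop := IsSubmodule {
  submod0 : W 0;
  submodD : forall a v w, W v -> W w -> W (a *: v + w);
  submod_act : forall x v, W v -> W (act x v)
}.

Definition irreducible_module : Prop :=
  (exists v : V, v != 0) /\
  forall W : V -> Prop, is_submodule W ->
    (forall v, W v -> v = 0) \/ (forall v, W v).

(* [env_orbit v] is U(L) v: the enveloping algebra is spanned by the words
   x_1 ... x_k (k >= 0) in elements of L, and such a word acts on v as
   [act x_1 (... (act x_k v))]. *)
Definition env_orbit (v w : V) : Prop :=
  exists s : seq (F * seq L), w = \sum_(p <- s) p.1 *: foldr act v p.2.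

End LieModules.

Notation Gamma := (int * int)%type.

Definition det2 (a b : Gamma) : int := a.1 * b.2 - a.2 * b.1.

Definition Gamma_coord (i : 'I_2) (m : Gamma) : int := if i == 0 then m.1 else m.2.

Definition is_Zbasis (b1 b2 : Gamma) : Prop :=
  forall m : Gamma, exists! z : int * int, m = b1 *~ z.1 + b2 *~ z.2.

(* Indices of K and d are shifted to start at 0. *)
Inductive Lidx :=
  | It of {m : Gamma | m != 0}
  | IE of {m : Gamma | m != 0}
  | IK of 'I_4
  | Id of 'I_2.

Definition Lidx_code (i : Lidx) :
    ({m : Gamma | m != 0} + {m : Gamma | m != 0}) + ('I_4 + 'I_2) :=
  match i with
  | It m => inl (inl m) | IE m => inl (inr m)
  | IK j => inr (inl j) | Id j => inr (inr j)
  end.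
Definition Lidx_decode
    (c : ({m : Gamma | m != 0} + {m : Gamma | m != 0}) + ('I_4 + 'I_2)) : Lidx :=
  match c with
  | inl (inl m) => It m | inl (inr m) => IE m
  | inr (inl j) => IK j | inr (inr j) => Id j
  end.
Lemma Lidx_codeK : cancel Lidx_code Lidx_decode. Proof. by case. Qed.
HB.instance Definition _ := Choice.copy Lidx (can_type Lidx_codeK).

Section ToroidalAlgebra.
Variable F : numFieldType.

(* The vector space of finitely supported functions [Lidx -> F]. *)
Definition Ltilde := {malg F[Lidx]}.
HB.instance Definition _ := GRing.Lmodule.copy Ltilde {malg F[Lidx]}.

Definition Lbasis (i : Lidx) : Ltilde := << i >>.

(* [t_ 0 = E_ 0 = 0]. *)
Definition t_ (m : Gamma) : Ltilde := if insub m is Some m' then Lbasis (It m') else 0.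
Definition E_ (m : Gamma) : Ltilde := if insub m is Some m' then Lbasis (IE m') else 0.
Definition K_ (i : 'I_4) : Ltilde := Lbasis (IK i).
Definition d_ (i : 'I_2) : Ltilde := Lbasis (Id i).

Definition h_ (m : Gamma) : Ltilde :=
  m.1%:~R *: K_ (@Ordinal 4 0 isT) + m.2%:~R *: K_ (@Ordinal 4 1 isT).
Definition f_ (m : Gamma) : Ltilde :=
  m.1%:~R *: K_ (@Ordinal 4 2 isT) + m.2%:~R *: K_ (@Ordinal 4 3 isT).

Definition br_tE (m n : Gamma) : Ltilde :=
  (det2 n m)%:~R *: t_ (m + n) + (m + n == 0)%:R *: h_ m.
Definition br_EE (m n : Gamma) : Ltilde :=
  (det2 n m)%:~R *: E_ (m + n) + (m + n == 0)%:R *: f_ m.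

Definition br_basis (i j : Lidx) : Ltilde :=
  match i, j with
  | It m, IE n => br_tE (val m) (val n)
  | IE n, It m => - br_tE (val m) (val n)
  | IE m, IE n => br_EE (val m) (val n)
  | Id k, It m => (Gamma_coord k (val m))%:~R *: t_ (val m)
  | It m, Id k => - ((Gamma_coord k (val m))%:~R *: t_ (val m))
  | Id k, IE m => (Gamma_coord k (val m))%:~R *: E_ (val m)
  | IE m, Id k => - ((Gamma_coord k (val m))%:~R *: E_ (val m))
  | _, _ => 0
  end.

Definition Lbr (x y : Ltilde) : Ltilde :=
  \sum_(i <- msupp x) \sum_(j <- msupp y)
    (x@_i * y@_j) *: br_basis i j.

Section WeightModules.
Variables (V : lmodType F) (act : Ltilde -> V -> V).

(* A weight is a vector of F^2 x F^4: eigenvalues of the d_i, then of the K_j. *)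
Definition weight_space (lam : 'rV[F]_(2 + 4)) (v : V) : Prop :=
  (forall i : 'I_2, act (d_ i) v = lam 0 (lshift 4 i) *: v) /\
  (forall j : 'I_4, act (K_ j) v = lam 0 (rshift 2 j) *: v).

Definition finite_dim (W : V -> Prop) : Prop :=
  exists n : nat, exists b : 'I_n -> V, (forall i, W (b i)) /\
    forall v, W v -> exists a : 'I_n -> F, v = \sum_i a i *: b i.

(* V is the (internal) direct sum of its weight spaces. *)
Definition weight_module : Prop :=
  (forall v : V, exists s : seq 'rV[F]_(2 + 4), exists w : 'rV[F]_(2 + 4) -> V,
     [/\ uniq s, forall lam, weight_space lam (w lam) & v = \sum_(lam <- s) w lam]) /\
  (forall (s : seq 'rV[F]_(2 + 4)) (w : 'rV[F]_(2 + 4) -> V),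
     uniq s -> (forall lam, weight_space lam (w lam)) ->
     \sum_(lam <- s) w lam = 0 -> forall lam, lam \in s -> w lam = 0).

Definition Harish_Chandra_module : Prop :=
  [/\ irreducible_module act, weight_module &
      forall lam, finite_dim (weight_space lam)].

Definition GHW_module : Prop :=
  weight_module /\
  exists b1 b2 : Gamma, is_Zbasis b1 b2 /\
  exists v : V,
    [/\ v != 0,
        exists lam, weight_space lam v,
        forall w, env_orbit act v w &
        forall p q : nat, act (E_ (b1 *+ p + b2 *+ q)) v = 0 /\
                          act (t_ (b1 *+ p + b2 *+ q)) v = 0].

End WeightModules.
End ToroidalAlgebra.

Lemma det20m m : det2 0 m = 0. Proof. by rewrite /det2 !mul0r subr0. Qed.
Lemma det2m0 m : det2 m 0 = 0. Proof. by rewrite /det2 !mulr0 subr0. Qed.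
Lemma det2C m n : det2 m n = - det2 n m.
Proof. by rewrite /det2 opprB [n.1 * _]mulrC [n.2 * _]mulrC. Qed.

Lemma Gamma_ind (P : Gamma -> Prop) :
  P 0 -> (forall m : {m : Gamma | m != 0}, P (val m)) -> forall m, P m.
Proof. by move=> P0 Pv m; case: (eqVneq m 0) => [-> //|m0]; exact: (Pv (exist _ m m0)). Qed.

(* The Jacobi identity from the relations alone: over an abstract module,
   rewriting is not slowed down by unfolding {malg F[Lidx]}. *)
Section Jacobi.
Variables (F : numFieldType) (M : lmodType F) (br : M -> M -> M).
Variables (t E : Gamma -> M) (K : 'I_4 -> M) (d : 'I_2 -> M) (k1 k2 k3 k4 : 'I_4).
Let h (m : Gamma) : M := m.1%:~R *: K k1 + m.2%:~R *: K k2.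
Let f (m : Gamma) : M := m.1%:~R *: K k3 + m.2%:~R *: K k4.
Hypothesis brDl : forall a x y z, br (a *: x + y) z = a *: br x z + br y z.
Hypothesis brC : forall x y, br x y = - br y x.
Hypothesis br_tt : forall m n, br (t m) (t n) = 0.
Hypothesis br_tE : forall m n, br (t m) (E n) =
  (det2 n m)%:~R *: t (m + n) + (m + n == 0)%:R *: h m.
Hypothesis br_EE : forall m n, br (E m) (E n) =
  (det2 n m)%:~R *: E (m + n) + (m + n == 0)%:R *: f m.
Hypothesis br_dt : forall i m, br (d i) (t m) = (Gamma_coord i m)%:~R *: t m.
Hypothesis br_dE : forall i m, br (d i) (E m) = (Gamma_coord i m)%:~R *: E m.
Hypothesis br_dd : forall i j, br (d i) (d j) = 0.
Hypothesis br_Kl : forall j x, br (K j) x = 0.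
Hypothesis gen_ind : forall P : M -> Prop,
  P 0 -> (forall a x y, P x -> P y -> P (a *: x + y)) ->
  (forall m, P (t m)) -> (forall m, P (E m)) -> (forall j, P (K j)) ->
  (forall i, P (d i)) -> forall x, P x.

Let brDr a x y z : br x (a *: y + z) = a *: br x y + br x z.
Proof. by rewrite brC brDl opprD -scalerN -!brC. Qed.

Let br0l z : br 0 z = 0.
Proof. by have := brDl (-1) 0 0 z; rewrite !scaleN1r !addNr. Qed.

Let br0r x : br x 0 = 0. Proof. by rewrite brC br0l oppr0. Qed.

Let brZr a x z : br x (a *: z) = a *: br x z.
Proof. by rewrite -[a *: z]addr0 brDr br0r addr0. Qed.

Let h_N m : h (- m) = - h m.
Proof. by rewrite /h !mulrNz !scaleNr opprD. Qed.

Let X b m := if b then t m else E m.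
Let Z b m := if b then h m else f m.

Let br_X a b m n : br (X a m) (X b n) =
  if a && b then 0 else
  (det2 n m)%:~R *: X (a || b) (m + n) + (m + n == 0)%:R *: Z (a || b) m.
Proof.
case: a b => [] []; rewrite /X /Z /=;
  [exact: br_tt | exact: br_tE | | exact: br_EE].
rewrite brC br_tE opprD [det2 m n]det2C mulrNz scaleNr opprK [n + m]addrC; congr (_ + _).
have [emn|_] := eqVneq (m + n) 0; last by rewrite /= !mulr0n !scale0r oppr0.
by move/eqP: emn; rewrite addr_eq0 => /eqP ->; rewrite /= !mulr1n !scale1r h_N.
Qed.

Let br_dX i b m : br (d i) (X b m) = (Gamma_coord i m)%:~R *: X b m.
Proof. by case: b; [exact: br_dt | exact: br_dE]. Qed.

Let br_Zr b m x : br x (Z b m) = 0.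
Proof.
have Kr j : br x (K j) = 0 by rewrite brC br_Kl oppr0.
have KZ a j a' j' : br x (a *: K j + a' *: K j') = 0.
  by rewrite brDr brZr !Kr !scaler0 addr0.
by case: b; rewrite /Z KZ.
Qed.

Let J x y z := br x (br y z) + br y (br z x) + br z (br x y).

Let J_rot x y z : J x y z = J y z x.
Proof. by rewrite /J -addrA addrC. Qed.

Let JE (w1 w2 w3 v1 v2 v3 : M) :
    w1 + v1 + (w2 + v2) + (w3 + v3) = w1 + w2 + w3 + (v1 + v2 + v3).
Proof. by rewrite [w1 + v1 + (w2 + v2)]addrACA [LHS]addrACA. Qed.

Let JDl a x x' y z : J (a *: x + x') y z = a *: J x y z + J x' y z.
Proof.
rewrite /J [br (a *: x + x') _]brDl [br (a *: x + x') y]brDl.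
by rewrite [br z (a *: x + x')]brDr !(brDr a) JE !scalerDr.
Qed.

Let J_K j y z : J (K j) y z = 0.
Proof. by rewrite /J [br z _]brC !br_Kl oppr0 !br0r !addr0. Qed.

Let J_XXX a b c m n p : J (X a m) (X b n) (X c p) = 0.
Proof.
have LL u v w k l q : br (X u k) (br (X v l) (X w q)) =
    if [|| u && v, v && w | u && w] then 0 else
    (det2 q l * det2 (l + q) k)%:~R *: X [|| u, v | w] (k + (l + q))
    + (det2 q l)%:~R *: ((k + (l + q) == 0)%:R *: Z [|| u, v | w] k).
  rewrite br_X; case: (boolP (v && w)) => [|vw]; first by rewrite br0r orbT.
  rewrite brDr brZr br_Zr scaler0 addr0 br_X.
  rewrite andb_orr orFb; case: ifP => _; first by rewrite scaler0.
  by rewrite scalerDr scalerA -intrM.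
rewrite /J !LL.
have -> : [|| b && c, c && a | b && a] = [|| a && b, b && c | a && c].
  by case: a b c => [] [] [].
have -> : [|| c && a, a && b | c && b] = [|| a && b, b && c | a && c].
  by case: a b c => [] [] [].
case: ifP => _; first by rewrite !addr0.
have -> : [|| b, c | a] = [|| a, b | c] by case: a b c => [] [] [].
have -> : [|| c, a | b] = [|| a, b | c] by case: a b c => [] [] [].
have -> : n + (p + m) = m + (n + p) by rewrite addrA addrC.
have -> : p + (m + n) = m + (n + p) by rewrite addrC addrA.
set s := [|| _, _ | _].
rewrite JE -!scalerDl -!intrD.
have -> : det2 p n * det2 (n + p) m + det2 m p * det2 (p + m) n
          + det2 n m * det2 (m + n) p = 0 by rewrite /det2 /=; ring.
rewrite scale0r add0r; have [emn|_] := eqVneq (m + (n + p)) 0; last first.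
  by rewrite /= !mulr0n !scale0r !scaler0 !addr0.
move/eqP: emn; rewrite addr_eq0 => /eqP ->; rewrite /= !mulr1n !scale1r.
have ZE k A B (c1 c2 c3 : int) : c1 * k.1 + c2 * n.1 + c3 * p.1 = 0 ->
    c1 * k.2 + c2 * n.2 + c3 * p.2 = 0 ->
  c1%:~R *: (k.1%:~R *: A + k.2%:~R *: B) + c2%:~R *: (n.1%:~R *: A + n.2%:~R *: B)
  + c3%:~R *: (p.1%:~R *: A + p.2%:~R *: B) = 0 :> M.
  move=> e1 e2; rewrite !scalerDr !scalerA JE -!scalerDl.
  by rewrite -!intrM -!intrD e1 e2 !scale0r addr0.
by rewrite /Z; case: s; apply: ZE; rewrite /det2 /=; ring.
Qed.

Let J_dXX i a b m n : J (d i) (X a m) (X b n) = 0.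
Proof.
rewrite /J [br (X b n) (d i)]brC !br_dX -scaleNr !brZr.
rewrite [br (X b n) _]brC br_X; case: ifP => _.
  by rewrite br0r oppr0 !scaler0 !addr0.
rewrite brDr brZr br_Zr br_dX scaler0 addr0 scalerN.
rewrite scaleNr -addrA -opprD -scalerDl scalerDr [_ *: (_ *: Z _ _)]scalerA.
rewrite opprD addrA !scalerA -scalerBl.
have cD : Gamma_coord i (m + n) = Gamma_coord i m + Gamma_coord i n.
  by rewrite /Gamma_coord; case: ifP.
rewrite -intrD -!intrM -intrB /= cD.
have [emn|_] := eqVneq (m + n) 0; last first.
  rewrite /= mulr0n mulr0 scale0r subr0 [_ + Gamma_coord i m]addrC mulrC.
  by rewrite [_ * det2 _ _]mulrC subrr scale0r.
move/eqP: emn; rewrite addr_eq0 => /eqP emn; have -> : Gamma_coord i m = - Gamma_coord i n.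
  by rewrite emn /Gamma_coord; case: ifP.
by rewrite addNr !subrr mulr0 mul0r subrr !mulr0z mul0r !scale0r subrr.
Qed.

Let J_ddX i j b m : J (d i) (d j) (X b m) = 0.
Proof.
rewrite /J br_dd br0r addr0 [br (X b m) _]brC !br_dX -scaleNr !brZr !br_dX.
by rewrite !scalerA -scalerDl mulNr mulrC subrr scale0r.
Qed.

Let X_ind (P : M -> Prop) :
  P 0 -> (forall a x y, P x -> P y -> P (a *: x + y)) ->
  (forall b m, P (X b m)) -> (forall j, P (K j)) -> (forall i, P (d i)) ->
  forall x, P x.
Proof.
move=> P0 PD PX PK Pd; apply: gen_ind => // m; [exact: (PX true)|exact: (PX false)].
Qed.

Lemma lie_bracket_gen : is_lie_bracket br.
Proof.
have J0 u v : J 0 u v = 0 by rewrite /J br0l br0r !br0l !br0r !addr0.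
have JD u v a w w' : J w u v = 0 -> J w' u v = 0 -> J (a *: w + w') u v = 0.
  by move=> e e'; rewrite JDl e e' scaler0 addr0.
have Jddd i j k : J (d i) (d j) (d k) = 0 by rewrite /J !br_dd !br0r !addr0.
have Jd i : forall y z, J (d i) y z = 0.
  move=> y z; rewrite J_rot; elim/X_ind: y => [|a w w'|b n|j|j]; [exact: J0|exact: JD| | exact: J_K |].
    rewrite J_rot; elim/X_ind: z => [|a w w'|c p|k|k]; [exact: J0|exact: JD| |exact: J_K|].
      by rewrite J_rot J_dXX.
    by rewrite J_ddX.
  rewrite J_rot; elim/X_ind: z => [|a w w'|c p|k|k]; [exact: J0|exact: JD| |exact: J_K|exact: Jddd].
  by rewrite J_rot J_ddX.
split; [exact: brDl | exact: brDr | move=> x | ].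
  have /eqP := brC x x; rewrite -addr_eq0 -mulr2n -scaler_nat scaler_eq0.
  by rewrite pnatr_eq0 => /eqP.
move=> x y z; rewrite -/(J x y z).
elim/X_ind: x => [|a w w'|a m|i|i]; [exact: J0|exact: JD| |exact: J_K|exact: Jd].
rewrite J_rot; elim/X_ind: y => [|? w w'|b n|j|j]; [exact: J0|exact: JD| |exact: J_K|exact: Jd].
rewrite J_rot; elim/X_ind: z => [|? w w'|c p|k|k]; [exact: J0|exact: JD| |exact: J_K|exact: Jd].
by rewrite J_rot; exact: J_XXX.
Qed.

End Jacobi.

(* Sanity check: the bracket relations hold for all m, n, and Lbr is a Lie bracket. *)
Section BracketTheory.
Variable F : numFieldType.
Implicit Types x y z : Ltilde F.
Local Notation Ltilde := (Ltilde F).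
Local Notation Lbasis := (Lbasis F).
Local Notation t_ := (t_ F).
Local Notation E_ := (E_ F).
Local Notation K_ := (K_ F).
Local Notation d_ := (d_ F).
Local Notation h_ := (h_ F).
Local Notation f_ := (f_ F).
Local Notation br_EE := (br_EE F).
Local Notation br_basis := (br_basis F).

Lemma LbrE (dx dy : {fset Lidx}) x y :
    (msupp x `<=` dx)%fset -> (msupp y `<=` dy)%fset ->
  Lbr x y = \sum_(i <- dx) \sum_(j <- dy) (x@_i * y@_j) *: br_basis i j.
Proof.
move=> lex ley; rewrite /Lbr (big_fset_incl _ lex) => [|i _ /mcoeff_outdom xi].
  apply: eq_bigr => i _; apply: big_fset_incl ley _ => j _ /mcoeff_outdom yj.
  by rewrite yj mulr0 scale0r.
by apply: big1 => j _; rewrite xi mul0r scale0r.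
Qed.

Lemma LbrDl a x y z : Lbr (a *: x + y) z = a *: Lbr x z + Lbr y z.
Proof.
pose d := (msupp (a *: x + y) `|` (msupp x `|` msupp y))%fset.
have H : (msupp (a *: x + y) `<=` d)%fset by exact: fsubsetUl.
have Hx : (msupp x `<=` d)%fset.
  by apply: fsubset_trans (fsubsetUr _ _); exact: fsubsetUl.
have Hy : (msupp y `<=` d)%fset.
  by apply: fsubset_trans (fsubsetUr _ _); exact: fsubsetUr.
have Hz := fsubset_refl (msupp z).
rewrite (LbrE H Hz) (LbrE Hx Hz) (LbrE Hy Hz).
rewrite scaler_sumr -big_split /=; apply: eq_bigr => i _.
rewrite scaler_sumr -big_split /=; apply: eq_bigr => j _.
by rewrite mcoeffD mcoeffZ mulrDl scalerDl -mulrA scalerA.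
Qed.

Lemma LbrDr a x y z : Lbr x (a *: y + z) = a *: Lbr x y + Lbr x z.
Proof.
pose d := (msupp (a *: y + z) `|` (msupp y `|` msupp z))%fset.
have H : (msupp (a *: y + z) `<=` d)%fset by exact: fsubsetUl.
have Hy : (msupp y `<=` d)%fset.
  by apply: fsubset_trans (fsubsetUr _ _); exact: fsubsetUl.
have Hz : (msupp z `<=` d)%fset.
  by apply: fsubset_trans (fsubsetUr _ _); exact: fsubsetUr.
have Hx := fsubset_refl (msupp x).
rewrite (LbrE Hx H) (LbrE Hx Hy) (LbrE Hx Hz).
rewrite scaler_sumr -big_split /=; apply: eq_bigr => i _.
rewrite scaler_sumr -big_split /=; apply: eq_bigr => j _.
by rewrite mcoeffD mcoeffZ mulrDr scalerDl mulrCA scalerA.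
Qed.

Lemma Lbr0l z : Lbr 0 z = 0.
Proof. by have := LbrDl (-1) 0 0 z; rewrite !scaleN1r !addNr. Qed.

Lemma Lbr0r x : Lbr x 0 = 0.
Proof. by have := LbrDr (-1) x 0 0; rewrite !scaleN1r !addNr. Qed.

Lemma LbrZl a x z : Lbr (a *: x) z = a *: Lbr x z.
Proof. by rewrite -[a *: x]addr0 LbrDl Lbr0l addr0. Qed.

Lemma LbrZr a x z : Lbr x (a *: z) = a *: Lbr x z.
Proof. by rewrite -[a *: z]addr0 LbrDr Lbr0r addr0. Qed.

Lemma Lbr_basis i j : Lbr (Lbasis i) (Lbasis j) = br_basis i j.
Proof.
by rewrite /Lbr /Lbasis !msuppU oner_eq0 !big_seq_fset1 !mcoeffUU mulr1 scale1r.
Qed.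

Lemma Lbasis_ind (P : Ltilde -> Prop) :
    P 0 -> (forall a x y, P x -> P y -> P (a *: x + y)) ->
    (forall i, P (Lbasis i)) ->
  forall x, P x.
Proof.
move=> P0 PD Pb x; rewrite (monalgE x); elim: (enum_fset (msupp x)) => [|i s IH].
  by rewrite big_nil.
rewrite big_cons; set y := mkmalgU _ _.
suff ->: y = x@_i *: Lbasis i by apply: PD.
by apply/malgP => k; rewrite /y mcoeffZ !mcoeffU mulrnAr mulr1.
Qed.

Lemma t_0 : t_ 0 = 0. Proof. by rewrite /t_ insubF ?eqxx. Qed.
Lemma E_0 : E_ 0 = 0. Proof. by rewrite /E_ insubF ?eqxx. Qed.
Lemma t_val m : t_ (val m) = Lbasis (It m). Proof. by rewrite /t_ valK. Qed.
Lemma E_val m : E_ (val m) = Lbasis (IE m). Proof. by rewrite /E_ valK. Qed.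

Lemma h_0 : h_ 0 = 0. Proof. by rewrite /h_ [_.1]/(0 : int) [_.2]/(0 : int) mulr0z !scale0r addr0. Qed.
Lemma f_0 : f_ 0 = 0. Proof. by rewrite /f_ [_.1]/(0 : int) [_.2]/(0 : int) mulr0z !scale0r addr0. Qed.
Lemma h_N m : h_ (- m) = - h_ m.
Proof. by rewrite /h_ !rmorphN /= !scaleNr opprD. Qed.
Lemma f_N m : f_ (- m) = - f_ m.
Proof. by rewrite /f_ !rmorphN /= !scaleNr opprD. Qed.

Lemma Lbr_tt m n : Lbr (t_ m) (t_ n) = 0.
Proof.
elim/Gamma_ind: m => [|m]; first by rewrite t_0 Lbr0l.
elim/Gamma_ind: n => [|n]; first by rewrite t_0 Lbr0r.
by rewrite !t_val Lbr_basis.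
Qed.

Lemma Lbr_tE m n : Lbr (t_ m) (E_ n) =
  (det2 n m)%:~R *: t_ (m + n) + (m + n == 0)%:R *: h_ m.
Proof.
elim/Gamma_ind: m => [|m].
  by rewrite t_0 Lbr0l det2m0 h_0 scale0r scaler0 addr0.
elim/Gamma_ind: n => [|n]; last by rewrite t_val E_val Lbr_basis.
rewrite E_0 Lbr0r det20m scale0r add0r addr0.
by rewrite (negPf (valP m)) /= mulr0n scale0r.
Qed.

Lemma Lbr_EE m n : Lbr (E_ m) (E_ n) =
  (det2 n m)%:~R *: E_ (m + n) + (m + n == 0)%:R *: f_ m.
Proof.
elim/Gamma_ind: m => [|m].
  by rewrite E_0 Lbr0l det2m0 f_0 scale0r scaler0 addr0.
elim/Gamma_ind: n => [|n]; last by rewrite !E_val Lbr_basis.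
rewrite E_0 Lbr0r det20m scale0r add0r addr0.
by rewrite (negPf (valP m)) /= mulr0n scale0r.
Qed.

Lemma Lbr_dt i m : Lbr (d_ i) (t_ m) = (Gamma_coord i m)%:~R *: t_ m.
Proof.
by elim/Gamma_ind: m => [|m]; rewrite ?t_0 ?Lbr0r ?scaler0 // t_val Lbr_basis /= t_val.
Qed.

Lemma Lbr_dE i m : Lbr (d_ i) (E_ m) = (Gamma_coord i m)%:~R *: E_ m.
Proof.
by elim/Gamma_ind: m => [|m]; rewrite ?E_0 ?Lbr0r ?scaler0 // E_val Lbr_basis /= E_val.
Qed.

Lemma Lbr_dd i j : Lbr (d_ i) (d_ j) = 0. Proof. exact: Lbr_basis. Qed.

Lemma Lbr_Kl j x : Lbr (K_ j) x = 0.
Proof.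
elim/Lbasis_ind: x => [|a x y Hx Hy|i]; first exact: Lbr0r.
  by rewrite LbrDr Hx Hy scaler0 addr0.
by rewrite Lbr_basis.
Qed.

Let br_EEC m n : br_EE m n = - br_EE n m.
Proof.
rewrite /br_EE [det2 n m]det2C mulrNz scaleNr [n + m]addrC opprD; congr (_ + _).
have [emn|_] := eqVneq (m + n) 0; last by rewrite /= mulr0n !scale0r oppr0.
by move/eqP: emn; rewrite addr_eq0 => /eqP ->; rewrite /= mulr1n !scale1r f_N.
Qed.

Lemma LbrC x y : Lbr x y = - Lbr y x.
Proof.
have N0 : 0 = - 0 :> Ltilde by rewrite oppr0.
have NK (u : Ltilde) : u = - - u by rewrite opprK.
elim/Lbasis_ind: x => [|a x z Hx Hz|i]; first by rewrite Lbr0l Lbr0r oppr0.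
  by rewrite LbrDl LbrDr Hx Hz opprD scalerN.
elim/Lbasis_ind: y => [|a x z Hx Hz|j]; first by rewrite Lbr0l Lbr0r oppr0.
  by rewrite LbrDl LbrDr Hx Hz opprD scalerN.
rewrite !Lbr_basis; case: i => [m|m|k|k]; case: j => [n|n|l|l];
  rewrite /br_basis; [ exact: N0 | exact: NK | exact: N0 | exact: erefl
  | exact: erefl | exact: br_EEC | exact: N0 | exact: erefl
  | exact: N0 | exact: N0 | exact: N0 | exact: N0
  | exact: NK | exact: NK | exact: N0 | exact: N0 ].
Qed.

Lemma Lbr_lie : is_lie_bracket (@Lbr F).
Proof.
apply: (lie_bracket_gen LbrDl LbrC Lbr_tt Lbr_tE Lbr_EE Lbr_dt Lbr_dE Lbr_dd Lbr_Kl).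
move=> P P0 PD Pt PE PK Pd; apply: Lbasis_ind; [exact: P0 | exact: PD |] => -[m|m|j|i].
- by rewrite -t_val; exact: Pt.
- by rewrite -E_val; exact: PE.
- exact: PK.
- exact: Pd.
Qed.

End BracketTheory.

(* Main.v *)
(** Restricted to the operators [x_k = E(km)] and [y_k = X(-km)], where X is E
or t and m is a primitive vector at which K_3, K_4 (resp. K_1, K_2) give a
nonzero scalar, V is a Heisenberg module of nonzero central charge with
finite-dimensional graded pieces. Common eigenvectors of the commuting operators
[y_k x_k] then produce a weight vector v killed by E(km) for all k >= N, up to
replacing m by -m. For (n, m) a basis of Gamma and X in {E, t}, a linear
relation between the vectors [y_k X(n + km) v] of one weight space gives
[X(n + jm) v = 0] for j large; brackets extend this to a cone around a basis. *)

Require Import Defs.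
From mathcomp Require Import all_boot all_order all_algebra.
From mathcomp Require Import complex reals.
From mathcomp Require Import boolp ring zify.
Import GRing.Theory.
Local Open Scope ring_scope.
Import Num.Theory.
Set Implicit Arguments.
Unset Strict Implicit.
Unset Printing Implicit Defensive.

(** * Linear operators and subspaces *)

Definition linear_op (F : fieldType) (U V : lmodType F) (T : U -> V) : Prop :=
  forall a v w, T (a *: v + w) = a *: T v + T w.

Definition subspace (F : fieldType) (V : lmodType F) (W : V -> Prop) : Prop :=
  W 0 /\ forall a v w, W v -> W w -> W (a *: v + w).

Section LinearOp.
Variables (F : fieldType) (U V : lmodType F) (T : U -> V).
Hypothesis linT : linear_op T.

Lemma linear_op0 : T 0 = 0.
Proof. by have := linT (-1) 0 0; rewrite !scaleN1r !addNr. Qed.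

Lemma linear_opD v w : T (v + w) = T v + T w.
Proof. by have := linT 1 v w; rewrite !scale1r. Qed.

Lemma linear_opZ a v : T (a *: v) = a *: T v.
Proof. by have := linT a v 0; rewrite linear_op0 !addr0. Qed.

Lemma linear_op_sum (I : Type) (r : seq I) (P : pred I) (v : I -> U) :
  T (\sum_(i <- r | P i) v i) = \sum_(i <- r | P i) T (v i).
Proof. by rewrite (big_morph T linear_opD linear_op0). Qed.

End LinearOp.

(** * Dimension bounds through linear relations *)

Section FiniteDim.
Variables (F : fieldType) (V : lmodType F).
Implicit Types (W : V -> Prop) (n : nat).

(** Phrased as a supply of linear relations: such a bound passes to subspaces at once, and the
    relation itself is what later arguments use. *)
Definition dimle n W : Prop := forall v : 'I_n.+1 -> V, (forall i, W (v i)) ->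
  exists a : 'I_n.+1 -> F, (exists i, a i != 0) /\ \sum_i a i *: v i = 0.

Lemma subspace_sum W (I : Type) (r : seq I) (P : pred I) (a : I -> F) (v : I -> V) :
  subspace W -> (forall i, W (v i)) -> W (\sum_(i <- r | P i) a i *: v i).
Proof.
move=> [W0 WD] Wv; elim: r => [|i r IH]; first by rewrite big_nil.
by rewrite big_cons; case: ifP => // _; apply: WD.
Qed.

Lemma subspace_scale W a v : subspace W -> W v -> W (a *: v).
Proof. by move=> [W0 WD] Wv; rewrite -[_ *: _]addr0; apply: WD. Qed.

(** Adjoin [u] to vectors of [W']: in the resulting relation [u] has coefficient zero, since
    otherwise [u] would lie in [W']. *)
Lemma dimle_proper n W W' u : dimle n.+1 W -> subspace W' ->
  (forall v, W' v -> W v) -> W u -> ~ W' u -> dimle n W'.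
Proof.
move=> dW sW' W'W Wu nW'u v W'v.
pose v' (i : 'I_n.+2) := if unlift ord0 i is Some j then v j else u.
have [|a [[i ai]]] := dW v'.
  by move=> i; rewrite /v'; case: unliftP => [j _|_] //; apply: W'W.
rewrite big_ord_recl {1}/v' unlift_none => rel.
have rel' : \sum_i a (lift ord0 i) *: v i = - (a ord0 *: u).
  apply/eqP; rewrite -addr_eq0 addrC -[X in _ == X]rel; apply/eqP; congr (_ + _).
  by apply: eq_bigr => j _; rewrite /v' liftK.
have a0 : a ord0 = 0.
  apply/eqP/negPn/negP => a0; apply: nW'u.
  rewrite -[u](scalerK a0) -[_ *: u]opprK -rel' scalerN.
  rewrite -scaleNr; apply: subspace_scale => //.
  exact: subspace_sum.
exists (fun i => a (lift ord0 i)); split; last by rewrite rel' a0 scale0r oppr0.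
case: (unliftP ord0 i) ai => [j ->|->]; last by rewrite a0 eqxx.
by exists j.
Qed.

(** Eigenvectors with distinct characters are independent, so infinitely many of them cannot fit in
    [W]. *)
Lemma dimle_eigenvectors (I : Type) (T : I -> V -> V) (v : nat -> V)
    (chi : nat -> I -> F) n W :
  (forall i, linear_op (T i)) -> dimle n W ->
  (forall j, W (v j)) -> (forall j, v j != 0) ->
  (forall i j, T i (v j) = chi j i *: v j) ->
  ~ (forall j j', (j < j')%N -> exists i, chi j i != chi j' i).
Proof.
move=> linT dW Wv v0 Tv dist.
have dist' j j' : j != j' -> exists i, chi j i != chi j' i.
  rewrite neq_ltn => /orP[/dist //|lt_j'j].
  by have [k] := dist _ _ lt_j'j; exists k; rewrite eq_sym.
have indep s a : uniq s -> \sum_(j <- s) a j *: v j = 0 ->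
    forall j, j \in s -> a j = 0.
  elim: s a => [|j0 s IH] a //= /andP[j0s us] rel.
  have as0 j : j \in s -> a j = 0.
    move=> js; have [|i ij] := dist' j j0; first by apply: contraNneq j0s => <-.
    have := congr1 (fun w => T i w - chi j0 i *: w) rel => /=.
    rewrite (linear_op_sum (linT i)) (linear_op0 (linT i)) scaler0 subr0.
    rewrite scaler_sumr -sumrB big_cons.
    rewrite (linear_opZ (linT i)) Tv !scalerA mulrC subrr add0r => rel'.
    have/IH : \sum_(j <- s) (a j * (chi j i - chi j0 i)) *: v j = 0.
      rewrite -[RHS]rel'; apply: eq_bigr => l _.
      by rewrite (linear_opZ (linT i)) Tv !scalerA mulrBr scalerBl [a l * chi j0 i]mulrC.
    move/(_ us j js)/eqP; rewrite mulf_eq0 subr_eq0 (negPf ij) orbF.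
    by move/eqP.
  move=> j; rewrite inE => /orP[/eqP ->|]; last exact: as0.
  move: rel; rewrite big_cons big_seq big1 => [|l ls]; last by rewrite as0 ?scale0r.
  by rewrite addr0 => /eqP; rewrite scaler_eq0 (negPf (v0 j0)) orbF => /eqP.
have [a [[i ai] rel]] := dW (fun i => v (val i)) (fun i => Wv (val i)).
suff: a i = 0 by move/eqP: ai.
have := indep (iota 0 n.+1) (fun j => a (inord j)) (iota_uniq _ _).
rewrite [iota _ _](_ : _ = index_iota 0 n.+1) ?big_mkord; last by rewrite /index_iota subn0.
have rel' : \sum_(j < n.+1) a (inord j) *: v j = 0.
  by rewrite -[RHS]rel; apply: eq_bigr => j _; rewrite inord_val.
by move/(_ rel' (val i)); rewrite inord_val; apply; rewrite mem_index_iota ltn_ord.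
Qed.

End FiniteDim.

Lemma finite_dim_dimle (F : numFieldType) (V : lmodType F) (W : V -> Prop) : finite_dim W -> exists n, dimle n W.
Proof.
move=> [n [b [_ sb]]]; exists n => v Wv.
have [A vA] := choice (fun i => sb _ (Wv i)).
pose M : 'M[F]_(n.+1, n) := \matrix_(i, j) A i j.
have : kermx M != 0.
  by rewrite -mxrank_eq0 mxrank_ker subn_eq0 -ltnNge ltnS rank_leq_col.
case/rowV0Pn => u /sub_kermxP uM u0.
exists (fun i => u 0 i); split.
  case/rV0Pn: u0 => i ui; by exists i.
under eq_bigr => i _ do rewrite vA scaler_sumr.
rewrite exchange_big big1 // => j _ /=.
under eq_bigr do rewrite scalerA.
rewrite -scaler_suml; have /matrixP/(_ 0 j) := uM.
rewrite !mxE => uMj; rewrite [X in X *: _](_ : _ = 0) ?scale0r //.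
by rewrite -[RHS]uMj; apply: eq_bigr => i _; rewrite mxE.
Qed.

(** * Common eigenvectors over an algebraically closed field *)

Section CommonEigenvector.
Variables (F : closedFieldType) (V : lmodType F).
Implicit Types (W : V -> Prop).

(** Here [ev p] is [p(T) v]. From a nonzero [p] with [p(T) v = 0], linear factors [X - z] are
    removed until the quotient [q] has [q(T) v != 0]; this vector is an eigenvector for [z]. *)
Lemma eigenvector_exists (T : V -> V) W n v : linear_op T -> subspace W ->
  (forall w, W w -> W (T w)) -> dimle n W -> W v -> v != 0 ->
  exists z w, [/\ W w, w != 0 & T w = z *: w].
Proof.
move=> linT sW TW dW Wv v0.
pose ev (p : {poly F}) := \sum_(i < size p) p`_i *: iter i T v.
have evE (p : {poly F}) k : (size p <= k)%N -> ev p = \sum_(i < k) p`_i *: iter i T v.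
  move=> pk; rewrite /ev (big_ord_widen _ (fun i => p`_i *: iter i T v) pk) big_mkcond.
  by apply: eq_bigr => i _; case: ltnP => // /(nth_default 0) ->; rewrite scale0r.
have Wev (p : {poly F}) : W (ev p).
  by apply: subspace_sum => // i; elim: (val i) => //= k; apply: TW.
have evX (p : {poly F}) z : ev (('X - z%:P) * p) = T (ev p) - z *: ev p.
  have sp : (size (('X - z%:P) * p)%R <= (size p).+1)%N.
    by apply: leq_trans (size_polyMleq _ _) _; rewrite size_XsubC.
  rewrite (evE _ _ sp) {2}(evE p _ (leqnSn _)) /ev (linear_op_sum linT).
  rewrite scaler_sumr.
  under eq_bigr do rewrite mulrBl coefB coefXM coefCM scalerBl -scalerA.
  rewrite sumrB big_ord_recl /= scale0r add0r; congr (_ - _).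
  by apply: eq_bigr => i _; rewrite (linear_opZ linT).
have [p p0 evp] : exists2 p, p != 0 & ev p = 0.
  have [|a [[i ai] rel]] := dW (fun i => iter i T v).
    by move=> i; elim: (val i) => //= k; apply: TW.
  exists (\poly_(i < n.+1) a (inord i)).
    apply: contraNneq ai => /(congr1 (fun p : {poly F} => p`_i)).
    by rewrite coef_poly ltn_ord inord_val coef0 => ->.
  rewrite (evE _ _ (size_poly _ _)) -[RHS]rel; apply: eq_bigr => j _.
  by rewrite coef_poly ltn_ord inord_val.
have [k] := ubnP (size p); elim: k p p0 evp => // k IH p p0 evp pk.
have [p1|p1] := eqVneq (size p) 1.
  move: evp; rewrite /ev p1 big_ord1 => /eqP; rewrite scaler_eq0 (negPf v0) orbF.
  by rewrite -lead_coef_eq0 /lead_coef p1 in p0; rewrite (negPf p0).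
have [z /factor_theorem[q pq]] := closed_rootP p p1.
have q0 : q != 0 by apply: contraNneq p0 => q0; rewrite pq q0 mul0r.
have [evq|evq] := eqVneq (ev q) 0.
  apply: (IH q) => //; move: pk; rewrite pq size_Mmonic ?monicXsubC //.
  by rewrite size_XsubC addn2.
exists z, (ev q); split=> //.
by apply/eqP; rewrite -subr_eq0 -evX mulrC -pq evp.
Qed.

(** Induction on the dimension bound. If some [T i] is not scalar on [W], one of its eigenspaces is
    proper, nonzero and, by commutation, stable under the whole family; if all are scalar, any
    nonzero vector serves. *)
Lemma simultaneous_eigenvector (I : Type) (T : I -> V -> V) W n v :
  (forall i, linear_op (T i)) -> subspace W ->
  (forall i w, W w -> W (T i w)) ->
  (forall i j w, W w -> T i (T j w) = T j (T i w)) ->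
  dimle n W -> W v -> v != 0 ->
  exists w (chi : I -> F), [/\ W w, w != 0 & forall i, T i w = chi i *: w].
Proof.
move=> linT; elim: n W v => [|n IH] W v sW TW TC dW Wv v0.
  have [a [[i ai]]] := dW (fun=> v) (fun=> Wv).
  rewrite big_ord1 => /eqP; rewrite scaler_eq0 (negPf v0) orbF.
  by rewrite (ord1 i) in ai; rewrite (negPf ai).
have [scal|/existsNP[i /forallNP nscal]] :=
  pselect (forall i, exists z, forall w, W w -> T i w = z *: w).
  have [chi Hchi] := choice scal.
  by exists v, chi; split=> // i; apply: Hchi.
have [z [w [Ww w0 Tw]]] := eigenvector_exists (linT i) sW (TW i) dW Wv v0.
have /existsNP[u /not_implyP[Wu Tu]] := nscal z.
pose W' x := W x /\ T i x = z *: x.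
have sW' : subspace W'.
  case: sW => W0 WD; split; first by split; rewrite ?(linear_op0 (linT i)) ?scaler0.
  move=> a x y [Wx Tx] [Wy Ty]; split; first exact: WD.
  by rewrite linT Tx Ty scalerDr !scalerA mulrC.
have dW' : dimle n W'.
  by apply: (dimle_proper dW sW' _ Wu) => [x []|[]].
have [|||x [chi [[Wx _] x0 Tx]]] := IH W' w sW' _ _ dW' _ w0.
- move=> j x [Wx Tx]; split; first exact: TW.
  by rewrite TC // Tx (linear_opZ (linT j)).
- by move=> j k x [Wx _]; apply: TC.
- by [].
by exists x, chi.
Qed.

End CommonEigenvector.

(** * Vanishing along an orbit of Heisenberg operators *)

Lemma heisenberg_orbit_vanishes (F : numFieldType) (V : lmodType F)
    (x y : nat -> V -> V) (u : nat -> V) (W : V -> Prop) (n N : nat) (c eps : F) :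
  (forall k, linear_op (x k)) -> (forall k, linear_op (y k)) ->
  dimle n W -> (forall k, W (y k (u k))) ->
  (0 < N)%N -> c != 0 -> eps != 0 ->
  (forall k l v, (N <= k)%N -> (N <= l)%N ->
    x l (y k v) = y k (x l v) + (if k == l then l%:R * c else 0) *: v) ->
  (forall l j, (N <= l)%N -> x l (u j) = (l%:R * eps) *: u (j + l)%N) ->
  exists J, forall j, (J <= j)%N -> u j = 0.
Proof.
move=> linx liny dW Wyu N0 c0 eps0 xy xu.
have [a [[i0 ai0] rel]] := dW (fun i => y (N + i)%N (u (N + i)%N)) (fun=> Wyu _).
(* The relation with the indices of [u] shifted by [q]. For [l >= N], [x l] sends [A q] to a nonzero
   multiple of [A (q + l)], plus a multiple of [u (l + q)] when [l] is one of the [N + i]. *)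
pose A q := \sum_(i < n.+1) a i *: y (N + i)%N (u (N + i + q)%N).
have A0 : A 0 = 0 by rewrite -[RHS]rel; apply: eq_bigr => i _; rewrite addn0.
have xA l q : (N <= l)%N -> x l (A q) = (l%:R * eps) *: A (q + l)%N +
    \sum_(i < n.+1) (a i * (if (N + i)%N == l then l%:R * c else 0)) *: u (N + i + q)%N.
  move=> Nl; rewrite /A (linear_op_sum (linx l)) scaler_sumr -big_split /=.
  apply: eq_bigr => i _; rewrite (linear_opZ (linx l)) xy ?leq_addr // xu //.
  rewrite (linear_opZ (liny _)) scalerDr !scalerA addnA; congr (_ + _).
  by rewrite mulrC.
have xA_big l q : (N + n < l)%N -> x l (A q) = (l%:R * eps) *: A (q + l)%N.
  move=> Nl; rewrite xA; last by lia.
  rewrite [X in _ + X]big1 ?addr0 // => i _; case: eqP => [e|_].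
    by have := ltn_ord i; lia.
  by rewrite mulr0 scale0r.
have leps0 l : (N <= l)%N -> l%:R * eps != 0.
  by move=> Nl; rewrite mulf_neq0 // pnatr_eq0; lia.
have A_big l : (N + n < l)%N -> A l = 0.
  move=> Nl; have /eqP := xA_big _ 0 Nl.
  rewrite A0 (linear_op0 (linx l)) eq_sym scaler_eq0 (negPf (leps0 _ _)) ?add0n; last lia.
  by move/eqP.
(* At an index with nonzero coefficient, [x l0 (A 0) = 0] ties [u l0] to [A l0]. Since [A] vanishes
   at large indices, [x l] with [l] large kills [A l0] and hence [u l0], whose image is a nonzero
   multiple of [u (l0 + l)]. *)
pose l0 := (N + i0)%N; pose b := a i0 * (l0%:R * c).
have b0 : b != 0 by rewrite !mulf_neq0 // pnatr_eq0 /l0; lia.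
have rel0 : (l0%:R * eps) *: A l0 + b *: u l0 = 0.
  have := xA l0 0 (leq_addr _ _).
  rewrite A0 (linear_op0 (linx l0)) add0n (bigD1 i0) //= eqxx big1 => [|i ii0].
    by rewrite addr0 addn0.
  by rewrite eqn_add2l (negPf (_ : val i != val i0)) ?mulr0 ?scale0r.
exists (l0 + (N + n).+1)%N => j Jj.
have [l jl Nl] : exists2 l, j = (l0 + l)%N & (N + n < l)%N.
  by exists (j - l0)%N; lia.
have := congr1 (x l) rel0.
rewrite linx (linear_opZ (linx l)) (linear_op0 (linx l)) xA_big // A_big; last lia.
rewrite !scaler0 add0r xu; last lia.
rewrite -jl => /eqP; rewrite !scaler_eq0 (negPf b0) (negPf (leps0 _ _)); last lia.
by move/eqP.
Qed.

(** * A vector killed by almost half of the Heisenberg operators *)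

Section Heisenberg.
Variables (F : numClosedFieldType) (V : lmodType F).
Variables (x y : int -> V -> V) (c : F) (b : bool) (M : int -> V -> Prop).
Hypothesis linx : forall k, linear_op (x k).
Hypothesis liny : forall k, linear_op (y k).
Hypothesis c0 : c != 0.
Hypothesis xx : forall k l v, k + l != 0 -> x k (x l v) = x l (x k v).
Hypothesis yy : forall k l v, k + l != 0 -> y k (y l v) = y l (y k v).
Hypothesis xy : forall k l v,
  x k (y l v) = y l (x k v) + (if k == l then k%:~R * c else 0) *: v.
(** With [b] true the [y k] are the [x k] with indices reversed, as for X = E, and opposite [x k]
    need not commute. With [b] false they do, as for X = t at a vector where K_3 and K_4 give
    zero. *)
Hypothesis opp_xy : if b then forall k v, y k v = x (- k) v
  else (forall k v, x k (x (- k) v) = x (- k) (x k v)) /\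
       (forall k v, y k (y (- k) v) = y (- k) (y k v)).
Hypothesis subM : forall n, subspace (M n).
Hypothesis dimM : forall n, exists d, dimle d (M n).
Hypothesis Mx : forall n k v, M n v -> M (n + k) (x k v).
Hypothesis My : forall n k v, M n v -> M (n - k) (y k v).

(** The change that [x k] makes to the eigenvalue of [num l]; [y k] makes the opposite change. The
    index [- k] enters only when [y] is [x] reversed, since [num (- k)] then also contains [x k]. *)
Let sigma (k l : int) : F :=
  if (l == k) || b && (l == - k) then - (k%:~R * c) else 0.

Let num l v := y l (x l v).

Let lin_num l : linear_op (num l).
Proof. by move=> a v w; rewrite /num linx liny. Qed.

Let num_x k l v : num l (x k v) = x k (num l v) + sigma k l *: x k v.
Proof.
rewrite /num /sigma; have [->|lk] /= := eqVneq l k.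
  by rewrite xy eqxx scaleNr addrK.
have kl : (k == l) = false by rewrite eq_sym (negPf lk).
have [lNk|lNk] := eqVneq l (- k).
  rewrite lNk in lk kl *; rewrite andbT.
  move: opp_xy; case: (b) => [yE|[xx' _]] /=.
    have := xy k k v; rewrite eqxx !yE opprK => ->.
    by rewrite (linear_opD (linx k)) (linear_opZ (linx k)) scaleNr addrK.
  by rewrite -xx' xy kl !scale0r !addr0.
rewrite andbF scale0r addr0 xx; last by rewrite addr_eq0.
by rewrite xy kl scale0r addr0.
Qed.

Let num_y k l v : num l (y k v) = y k (num l v) - sigma k l *: y k v.
Proof.
rewrite /num /sigma; have [->|lk] /= := eqVneq l k.
  by rewrite xy eqxx (linear_opD (liny k)) (linear_opZ (liny k)) scaleNr opprK.
have [lNk|lNk] := eqVneq l (- k).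
  rewrite lNk in lk *; rewrite andbT.
  move: opp_xy; case: (b) => [yE|[_ yy']] /=.
    have := xy k k (x (- k) v); rewrite eqxx !yE opprK => ->.
    by rewrite scaleNr opprK.
  by rewrite scale0r subr0 xy (negPf lk) scale0r addr0 yy'.
rewrite andbF scale0r subr0 xy (negPf lk) scale0r addr0 yy //.
by rewrite addr_eq0.
Qed.

Let eig v chi := forall l, num l v = chi l *: v.

Let eig_x k v chi : eig v chi -> eig (x k v) (fun l => chi l + sigma k l).
Proof. by move=> e l; rewrite num_x e (linear_opZ (linx k)) -scalerDl. Qed.

Let eig_y k v chi : eig v chi -> eig (y k v) (fun l => chi l - sigma k l).
Proof. by move=> e l; rewrite num_y e (linear_opZ (liny k)) -scalerBl. Qed.

Let eig_iter k j v chi : eig v chi ->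
  eig (iter j (x k) v) (fun l => chi l + j%:R * sigma k l).
Proof.
move=> e; elim: j => [|j IH] l; first by rewrite mul0r addr0 e.
by rewrite /= (eig_x k IH) -addrA -natr1 mulrDl mul1r.
Qed.

Let M_iter k j n v : M n v -> M (n + k * j%:Z) (iter j (x k) v).
Proof.
move=> Mv; elim: j => [|j IH]; first by rewrite mulr0 addr0.
by rewrite (_ : n + _ = n + k * j%:Z + k) ?iterS; [exact: Mx | lia].
Qed.

(** On the [j]-th iterate [num k] takes the value [-(j + 1) k c], which is nonzero, so [x k] cannot
    kill that iterate. *)
Let iter_neq0 k j v chi : eig v chi -> v != 0 -> k != 0 ->
  chi k = - (k%:~R * c) -> iter j (x k) v != 0.
Proof.
move=> e v0 k0 chik; elim: j => //= j IH; apply: contraNneq IH => xv.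
have := eig_iter k j e k; rewrite /num xv (linear_op0 (liny k)) => /esym/eqP.
rewrite /sigma eqxx /= chik (_ : - _ + _ = - (j.+1%:R * (k%:~R * c))).
  by rewrite scaler_eq0 oppr_eq0 !mulf_eq0 pnatr_eq0 intr_eq0 (negPf k0) (negPf c0).
by rewrite -natr1; ring.
Qed.

Let sigma_same (s : int) (k l : nat) : s = 1 \/ s = -1 -> (0 < k)%N ->
  sigma (s * k) (s * l) = if k == l then - ((s * k)%:~R * c) else 0.
Proof.
move=> hs k0; rewrite /sigma (_ : (_ || _) = (k == l)) //.
apply/idP/idP; first by case/orP => [|/andP[_]]; case: hs => ->; lia.
by move/eqP => ->; rewrite eqxx.
Qed.

Section NoAnnihilatedVector.
Hypothesis not_annihilated : forall n (s : int) w N, s = 1 \/ s = -1 -> M n w ->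
  w != 0 -> exists2 k : nat, (N <= k)%N & x (s * k) w != 0.
Variables (v : V) (chi : int -> F).
Hypotheses (Mv : M 0 v) (v0 : v != 0) (eig_v : eig v chi).

(* Otherwise [y_(k+l) x_l x_k v], for a fixed k and infinitely many l, are
   nonzero vectors of [M 0] with distinct characters. *)
Let extremal_index (s : int) B : s = 1 \/ s = -1 ->
  exists p : nat, [/\ (B <= p)%N, (0 < p)%N & chi (s * p) = - ((s * p)%:~R * c)].
Proof.
move=> hs; apply: contrapT => /forallNP nex.
have sn0 (k : nat) : (0 < k)%N -> (s * k)%:~R * c != 0.
  by move=> k0; rewrite mulf_neq0 // intr_eq0; case: hs => ->; lia.
have [k k0 xkv] := not_annihilated 1 hs Mv v0.
have MK := Mx (s * k) Mv.
have ex_l N : exists l : nat, (N <= l)%N /\ x (s * l) (x (s * k) v) != 0.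
  by have [l] := not_annihilated N hs MK xkv; exists l.
have [g Hg] := choice ex_l.
pose l i := iter i (fun j => g j.+1) (g (k + B).+1).
have lS i : (l i < l i.+1)%N by have [] := Hg (l i).+1.
have l_ge i : (k + B < l i)%N.
  elim: i => [|i IH]; last exact: ltn_trans (lS i).
  by have [] := Hg (k + B).+1.
have l_mono i j : (i < j)%N -> (l i < l j)%N.
  elim: j => // j IH; rewrite ltnS leq_eqVlt => /orP[/eqP->|/IH h]; first exact: lS.
  exact: ltn_trans (lS j).
have xlv i : x (s * l i) (x (s * k) v) != 0.
  by case: i => [|i]; [have [] := Hg (k + B).+1 | have [] := Hg (l i).+1].
pose w i := y (s * (k + l i)%N) (x (s * l i) (x (s * k) v)).
have eig_w i := eig_y (s * (k + l i)%N) (eig_x (s * l i) (eig_x (s * k) eig_v)).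
have w0 i : w i != 0.
  (* If [w i] vanished, commuting [x] past [y] at the index [s * (k + l i)] would make [k + l i] a
     witness against [nex]: neither [x (s * k)] nor [x (s * l i)] shifts the eigenvalue there. *)
  apply/negP => /eqP wi0; apply: (nex (k + l i)%N); have := l_ge i => lgei.
  split; [lia|lia|]; apply/eqP; rewrite -addr_eq0.
  have := xy (s * (k + l i)%N) (s * (k + l i)%N) (x (s * l i) (x (s * k) v)).
  rewrite -/(w i) wi0 (linear_op0 (linx _)) eqxx -/(num _ _) (eig_x _ (eig_x _ eig_v)).
  rewrite !sigma_same //; try lia.
  have -> : (l i == (k + l i)%N) = false by lia.
  have -> : (k == (k + l i)%N) = false by lia.
  rewrite !addr0 -scalerDl => /esym/eqP.
  by rewrite scaler_eq0 (negPf (xlv i)) orbF.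
have [d dM] := dimM 0.
apply: (dimle_eigenvectors lin_num dM _ w0 (fun i j => eig_w j i)).
  move=> j; rewrite (_ : 0 = 0 + s * k + s * l j - s * (k + l j)%N); last by lia.
  by apply: My; apply: Mx; apply: Mx.
(* This index separates the characters: the factor [x (s * l i)] shifts the eigenvalue on [w i],
   while nothing shifts it on [w j]. *)
move=> i j ij; exists (s * l i).
have := l_mono _ _ ij; have := l_ge i; have := l_ge j => lj li lij.
rewrite !sigma_same //; try lia.
have -> : (k == l i) = false by lia.
have -> : (l j == l i) = false by lia.
have -> : ((k + l i)%N == l i) = false by lia.
have -> : ((k + l j)%N == l i) = false by lia.
rewrite eqxx !subr0 !addr0 -subr_eq0 addrC addKr oppr_eq0.
by apply: sn0; lia.
Qed.

(** Extremal indices [p] and [- q] of both signs let all powers of [x (- q)] and [x p] act without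
    killing [v]. The exponents [p r] and [q r] balance the degrees, so [M 0] receives infinitely
    many eigenvectors with distinct eigenvalues of [num p]. *)
Lemma annihilated_vector_contra : False.
Proof.
have [p [_ p0]] := extremal_index 0 (or_introl (erefl (1 : int))).
rewrite mul1r => chip.
(* Taking [q > p] excludes [q = p], where [x (- q)] would shift [num p] if [y] is [x] reversed. *)
have [q [pq q0]] := extremal_index p.+1 (or_intror (erefl (-1 : int))).
rewrite mulN1r => chiq.
pose v' r := iter (p * r) (x (- q%:Z)) v.
pose w r := iter (q * r) (x p) (v' r).
have eig_v' r := eig_iter (- q%:Z) (p * r) eig_v.
have eig_w r := eig_iter p (q * r) (eig_v' r).
have sigma_qp : sigma (- q%:Z) p = 0.
  by rewrite /sigma ifF //; apply/negP => /orP[|/andP[_]]; lia.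
have v'0 r : v' r != 0 by apply: (iter_neq0 _ eig_v) => //; lia.
have w0 r : w r != 0.
  apply: (iter_neq0 _ (eig_v' r) (v'0 r)); first by lia.
  by rewrite sigma_qp mulr0 addr0.
have [d dM] := dimM 0.
apply: (dimle_eigenvectors lin_num dM _ w0 (fun i j => eig_w j i)).
  move=> r; have -> : 0 = 0 + (- q%:Z) * (p * r)%N%:Z + p%:Z * (q * r)%N%:Z.
    by rewrite !PoszM; ring.
  by do 2! apply: M_iter.
move=> r r' rr'; exists p%:Z.
rewrite sigma_qp !mulr0 !addr0 (inj_eq (addrI _)) -subr_eq0 -mulrBl mulf_neq0 //.
  by rewrite subr_eq0 eqr_nat; apply/negP; rewrite eqn_pmul2l; lia.
by rewrite /sigma eqxx /= oppr_eq0 mulf_neq0 // intr_eq0; lia.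
Qed.

End NoAnnihilatedVector.

Lemma heisenberg_annihilated_vector v : M 0 v -> v != 0 ->
  exists n (s : int) w N, [/\ s = 1 \/ s = -1, M n w, w != 0 &
    forall k : nat, (N <= k)%N -> x (s * k) w = 0].
Proof.
move=> Mv v0; apply: contrapT => nex.
have [d dM] := dimM 0.
have [||w [chi [Mw w0 eig_w]]] := simultaneous_eigenvector lin_num (subM 0) _ _ dM Mv v0.
- by move=> l w Mw; rewrite (_ : 0 = 0 + l - l); [apply: My; apply: Mx | lia].
- move=> k l w _; rewrite {2}/num [LHS]num_y num_x (linear_opD (liny l)) (linear_opZ (liny l)).
  by rewrite addrK.
apply: (annihilated_vector_contra _ Mw w0 eig_w) => n s u N hs Mu u0.
apply: contrapT => /forall2NP H; apply: nex; exists n, s, u, N; split=> // k Nk.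
by case: (H k) => // /negP/negPn/eqP.
Qed.

End Heisenberg.

(** * Determinants and bases of the lattice Gamma *)

Section Lattice.
Implicit Types (m n p b : Gamma) (k l : int).

Lemma Gamma_mulz m k : m *~ k = (m.1 * k, m.2 * k).
Proof.
rewrite [m *~ k]surjective_pairing; congr (_, _).
  by rewrite (raddfMz (@fst int int)) mulrzz.
by rewrite (raddfMz (@snd int int)) mulrzz.
Qed.

Lemma Gamma_muln m (k : nat) : m *+ k = (m.1 * k%:Z, m.2 * k%:Z).
Proof. by rewrite -Gamma_mulz. Qed.

Lemma det2Dl m n p : det2 (m + n) p = det2 m p + det2 n p.
Proof. by rewrite /det2 /=; ring. Qed.

Lemma det2Dr m n p : det2 p (m + n) = det2 p m + det2 p n.
Proof. by rewrite /det2 /=; ring. Qed.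

Lemma det2Ml m n (k : nat) : det2 (m *+ k) n = k%:Z * det2 m n.
Proof. by rewrite /det2 Gamma_muln /=; ring. Qed.

Lemma det2Mr m n (k : nat) : det2 m (n *+ k) = k%:Z * det2 m n.
Proof. by rewrite /det2 Gamma_muln /=; ring. Qed.

Lemma det2_mulz m k l : det2 (m *~ k) (m *~ l) = 0.
Proof. by rewrite /det2 !Gamma_mulz /=; ring. Qed.

Lemma det2mm m : det2 m m = 0.
Proof. by rewrite /det2 mulrC subrr. Qed.

Lemma Gamma_mulz_eq0 m k : m != 0 -> (m *~ k == 0) = (k == 0).
Proof.
move=> m0; rewrite Gamma_mulz; apply/eqP/eqP => [[/eqP e1 /eqP e2]|->].
  apply: contraNeq m0 => k0; move: e1 e2; rewrite !mulf_eq0 (negPf k0) !orbF.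
  by rewrite [m]surjective_pairing /= => /eqP -> /eqP ->.
by rewrite !mulr0.
Qed.

(** Cramer's rule, with the determinant as its own inverse. *)
Lemma det2_is_Zbasis b1 b2 e : det2 b1 b2 = e -> e * e = 1 -> is_Zbasis b1 b2.
Proof.
case: b1 b2 => [a b] [c d] <- ee [p q].
have solve (z : int * int) : (p, q) = (a, b) *~ z.1 + (c, d) *~ z.2 <->
    p = a * z.1 + c * z.2 /\ q = b * z.1 + d * z.2.
  by rewrite !Gamma_mulz /=; split=> [[-> ->]|[-> ->]].
rewrite /det2 /= in ee.
exists ((a * d - b * c) * (p * d - q * c), (a * d - b * c) * (a * q - b * p)); split.
  apply/solve => /=; split.
    by rewrite -[LHS]mulr1 -ee; ring.
  by rewrite -[LHS]mulr1 -ee; ring.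
case=> z1 z2 /solve [-> ->] /=; congr (_, _).
  by rewrite -[RHS]mulr1 -ee; ring.
by rewrite -[RHS]mulr1 -ee; ring.
Qed.

End Lattice.

(** * Submodules generated by one vector *)

Section EnvOrbit.
Variables (F : fieldType) (L V : lmodType F) (act : L -> V -> V).
Hypothesis actDr : forall a x v w, act x (a *: v + w) = a *: act x v + act x w.

Lemma env_orbit_submodule v : is_submodule act (env_orbit act v).
Proof.
split.
- by exists [::]; rewrite big_nil.
- move=> a _ _ [s ->] [s' ->].
  exists ([seq (a * p.1, p.2) | p <- s] ++ s').
  rewrite big_cat /= big_map scaler_sumr; congr (_ + _).
  by apply: eq_bigr => p _; rewrite scalerA.
- move=> x _ [s ->]; exists [seq (p.1, x :: p.2) | p <- s].
  rewrite (linear_op_sum (actDr^~ x)) big_map; apply: eq_bigr => p _.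
  by rewrite (linear_opZ (actDr^~ x)).
Qed.

Lemma env_orbit_full v w : irreducible_module act -> v != 0 -> env_orbit act v w.
Proof.
move=> [_ irr] v0; case: (irr _ (env_orbit_submodule v)) => [orb0|]; last exact.
suff /orb0 v_eq0 : env_orbit act v v by rewrite v_eq0 eqxx in v0.
by exists [:: (1, [::])]; rewrite big_seq1 scale1r.
Qed.

End EnvOrbit.

(** * The action of the toroidal algebra on weight vectors *)

(* [L] is kept abstract: unification would otherwise unfold [{malg F[Lidx]}]. *)
Section ToroidalModule.
Variables (F : numClosedFieldType) (L V : lmodType F) (br : L -> L -> L).
Variables (act : L -> V -> V) (t E : Gamma -> L) (K : 'I_4 -> L) (d : 'I_2 -> L).
Variable c : 'rV[F]_4.
Implicit Types (m n : Gamma) (v w : V) (b : bool).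

Let h m : L := m.1%:~R *: K (@Ordinal 4 0 isT) + m.2%:~R *: K (@Ordinal 4 1 isT).
Let f m : L := m.1%:~R *: K (@Ordinal 4 2 isT) + m.2%:~R *: K (@Ordinal 4 3 isT).
Let weight_vector (lam : 'rV[F]_(2 + 4)) v : Prop :=
  (forall i, act (d i) v = lam 0 (lshift 4 i) *: v) /\
  (forall j, act (K j) v = lam 0 (rshift 2 j) *: v).

Hypothesis t0 : t 0 = 0.
Hypothesis E0 : E 0 = 0.
Hypothesis brC : forall x y, br x y = - br y x.
Hypothesis br_tt : forall m n, br (t m) (t n) = 0.
Hypothesis br_tE : forall m n, br (t m) (E n) =
  (det2 n m)%:~R *: t (m + n) + (m + n == 0)%:R *: h m.
Hypothesis br_EE : forall m n, br (E m) (E n) =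
  (det2 n m)%:~R *: E (m + n) + (m + n == 0)%:R *: f m.
Hypothesis br_dt : forall i m, br (d i) (t m) = (Gamma_coord i m)%:~R *: t m.
Hypothesis br_dE : forall i m, br (d i) (E m) = (Gamma_coord i m)%:~R *: E m.
Hypothesis br_Kl : forall j x, br (K j) x = 0.
Hypothesis lieV : is_lie_module br act.
Hypothesis actK : forall (i : 'I_4) v, act (K i) v = c 0 i *: v.

Let X b m v := act (if b then t m else E m) v.

(* The scalar by which [h m] ([b = true]) or [f m] ([b = false]) acts. *)
Let level b m : F :=
  if b then m.1%:~R * c 0 (@Ordinal 4 0 isT) + m.2%:~R * c 0 (@Ordinal 4 1 isT)
  else m.1%:~R * c 0 (@Ordinal 4 2 isT) + m.2%:~R * c 0 (@Ordinal 4 3 isT).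

Let lin_act x : linear_op (act x).
Proof. by move=> a v w; rewrite (actDr lieV). Qed.

Let act_Dl x y v : act (x + y) v = act x v + act y v.
Proof. by have := actDl lieV 1 x y v; rewrite !scale1r. Qed.

Let act_0l v : act 0 v = 0.
Proof. by apply: (addrI (act 0 v)); rewrite -act_Dl !addr0. Qed.

Let act_Zl a x v : act (a *: x) v = a *: act x v.
Proof. by have := actDl lieV a x 0 v; rewrite act_0l !addr0. Qed.

Let act_Nl x v : act (- x) v = - act x v.
Proof. by apply: (addIr (act x v)); rewrite -act_Dl !addNr act_0l. Qed.

Lemma lin_X b m : linear_op (X b m). Proof. exact: lin_act. Qed.

Lemma X0 b v : X b 0 v = 0.
Proof. by rewrite /X t0 E0 if_same act_0l. Qed.

Lemma act_level b m v : act (if b then h m else f m) v = level b m *: v.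
Proof.
by rewrite /level /h /f; case: b; rewrite act_Dl !act_Zl !actK !scalerA scalerDl.
Qed.

Let hN m : h (- m) = - h m.
Proof. by rewrite /h !mulrNz !scaleNr opprD. Qed.

(** Both families obey one relation: for [t], the sign from reversing the bracket is absorbed by the
    antisymmetry of [det2] and by [h (- m) = - h m]. *)
Lemma E_X_comm b m n v : X false m (X b n v) = X b n (X false m v) +
  ((det2 n m)%:~R *: X b (m + n) v + ((m + n == 0)%:R * level b m) *: v).
Proof.
have -> : X false m (X b n v) =
    X b n (X false m v) + act (br (E m) (if b then t n else E n)) v.
  by rewrite (act_br lieV) addrC subrK.
congr (_ + _); rewrite -scalerA -act_level /X; case: b; last first.
  by rewrite br_EE act_Dl !act_Zl.
rewrite brC br_tE act_Nl act_Dl !act_Zl opprD -scaleNr -mulrNz -det2C.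
rewrite [n + m]addrC; congr (_ + _); have [/eqP|_] := eqVneq (m + n) 0.
  by rewrite addr_eq0 => /eqP ->; rewrite hN act_Nl !scale1r.
by rewrite !scale0r oppr0.
Qed.

Lemma t_t_comm m n v : X true m (X true n v) = X true n (X true m v).
Proof.
apply/eqP; rewrite -subr_eq0 -(act_br lieV) br_tt.
by rewrite act_0l.
Qed.

Let wt m : 'rV[F]_(2 + 4) := row_mx (\row_i (Gamma_coord i m)%:~R) 0.

Lemma weight_vector_subspace lam : subspace (weight_vector lam).
Proof.
split; first by split=> ?; rewrite (linear_op0 (lin_act _)) scaler0.
move=> a v w [dv Kv] [dw Kw]; split=> i.
  by rewrite lin_act dv dw scalerDr !scalerA mulrC.
by rewrite lin_act Kv Kw scalerDr !scalerA mulrC.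
Qed.

Lemma weight_vector_X b lam m v :
  weight_vector lam v -> weight_vector (lam + wt m) (X b m v).
Proof.
move=> [dv Kv]; split=> i; rewrite mxE ?row_mxEl ?row_mxEr !mxE.
  have -> : act (d i) (X b m v) = X b m (act (d i) v) +
      act (br (d i) (if b then t m else E m)) v.
    by rewrite (act_br lieV) addrC subrK.
  rewrite dv (linear_opZ (lin_X b m)) scalerDl; congr (_ + _).
  by case: b; rewrite ?br_dt ?br_dE act_Zl.
have -> : act (K i) (X b m v) = X b m (act (K i) v).
  apply/eqP; rewrite -subr_eq0 -(act_br lieV) br_Kl.
  by rewrite act_0l.
by rewrite Kv (linear_opZ (lin_X b m)) addr0.
Qed.

Lemma wtD m n : wt (m + n) = wt m + wt n.
Proof.
apply/rowP => i; rewrite !mxE; case: splitP => j _; rewrite !mxE ?addr0 //.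
by rewrite /Gamma_coord -intrD; case: ifP.
Qed.

(** * Operators along a line and along a parallel line *)

Section Line.
Variables (m : Gamma) (b : bool).
Hypotheses (m0 : m != 0) (level0 : level b m != 0).
(** For X = t the Heisenberg argument also needs E(km) and E(-km) to commute. *)
Hypothesis level_f : b -> level false m = 0.

Lemma levelZ b' (k : int) : level b' (m *~ k) = k%:~R * level b' m.
Proof.
by rewrite /level Gamma_mulz /= !intrM; case: b'; ring.
Qed.

Lemma E_X_line (k l : int) v : X false (m *~ k) (X b (m *~ l) v) =
  X b (m *~ l) (X false (m *~ k) v) +
  (if k == - l then k%:~R * level b m else 0) *: v.
Proof.
rewrite E_X_comm det2_mulz scale0r add0r -mulrzDr Gamma_mulz_eq0 // levelZ addr_eq0.
by case: eqP; rewrite ?mul1r ?mul0r.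
Qed.

Lemma E_E_line (k l : int) v : k + l != 0 ->
  X false (m *~ k) (X false (m *~ l) v) = X false (m *~ l) (X false (m *~ k) v).
Proof.
move=> kl; rewrite E_X_comm det2_mulz scale0r add0r -mulrzDr Gamma_mulz_eq0 //.
by rewrite (negPf kl) mul0r scale0r addr0.
Qed.

Lemma annihilated_on_half_line lam v :
  (forall lam', finite_dim (weight_vector lam')) ->
  weight_vector lam v -> v != 0 ->
  exists lam' (s : int) w N, [/\ s = 1 \/ s = -1, weight_vector lam' w, w != 0 &
    forall k : nat, (N <= k)%N -> X false (m *~ s *+ k) w = 0].
Proof.
move=> fdV wv v0.
pose x k := X false (m *~ k); pose y k := X b (m *~ (- k)).
pose M (n : int) := weight_vector (lam + wt (m *~ n)).
have MX b' (i k : int) u : M i u -> M (i + k) (X b' (m *~ k) u).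
  by rewrite /M mulrzDr wtD addrA; apply: weight_vector_X.
(* The flag is negated: here [b] true means X = t, whereas the Heisenberg flag is true when
   [y k = x (- k)], that is for X = E. *)
have [|||||||||||n [s [w [N [hs Mw w0 xw]]]]] :=
  @heisenberg_annihilated_vector F V x y (level b m) (~~ b) M _ _ level0
    _ _ _ _ _ _ _ _ v _ v0.
- by move=> k; apply: lin_X.
- by move=> k; apply: lin_X.
- by move=> k l u kl; apply: E_E_line.
- move=> k l u kl; rewrite /y; case: (b); first exact: t_t_comm.
  by apply: E_E_line; rewrite -opprD oppr_eq0.
- by move=> k l u; rewrite /x /y E_X_line opprK.
- rewrite /x /y; case: b level_f => [/(_ isT) lf|_] //=; split=> k u; last exact: t_t_comm.
  by rewrite E_X_comm det2_mulz scale0r add0r levelZ lf !mulr0 scale0r addr0.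
- by move=> n; apply: weight_vector_subspace.
- by move=> n; apply: finite_dim_dimle; apply: fdV.
- by move=> n k u; apply: MX.
- by move=> n k u; apply: MX.
- by rewrite /M mulr0z (_ : wt 0 = 0) ?addr0 //; apply: (addrI (wt 0)); rewrite -wtD !addr0.
by exists (lam + wt (m *~ n)), s, w, N; split=> // k Nk; rewrite -(xw k Nk) /x mulrzA.
Qed.

(** As E(lm) kills [v] for large [l], it moves [u j = X(n + jm) v] to [u (j + l)] with factor
    [l * det2 n m], and every [y k (u k)] has weight [lam + wt n]. *)
Lemma adjacent_line_vanishes b' n N lam v :
  (forall lam', finite_dim (weight_vector lam')) ->
  weight_vector lam v -> det2 n m != 0 ->
  (forall k : nat, (N <= k)%N -> X false (m *+ k) v = 0) ->
  exists J, forall j : nat, (J <= j)%N -> X b' (n + m *+ j) v = 0.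
Proof.
move=> fdV wv nm Ev.
have [D dW] := finite_dim_dimle (fdV (lam + wt n)).
(* The bound [maxn N 1] keeps out the index 0, where the factor [l] vanishes. *)
apply: (@heisenberg_orbit_vanishes F V (fun k => X false (m *+ k))
  (fun k => X b (m *~ (- k%:Z))) _ _ D (maxn N 1) (level b m) (det2 n m)%:~R _ _ dW).
- by move=> k; apply: lin_X.
- by move=> k; apply: lin_X.
- move=> k; rewrite (_ : lam + wt n = lam + wt (n + m *+ k) + wt (m *~ (- k%:Z))).
    by apply: weight_vector_X; apply: weight_vector_X.
  by rewrite -addrA -wtD mulrNz addrK.
- by rewrite leq_max orbT.
- exact: level0.
- by rewrite intr_eq0.
- move=> k l u _ _; have := E_X_line l%:Z (- k%:Z) u.
  by rewrite opprK eqz_nat [l == k]eq_sym => ->.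
- move=> l j; rewrite geq_max => /andP[Nl l0]; rewrite E_X_comm Ev //.
  rewrite (linear_op0 (lin_X _ _)) add0r.
  have d2 : det2 (n + m *+ j) (m *+ l) = l%:Z * det2 n m.
    by rewrite det2Dl !det2Mr det2Ml det2mm !mulr0 addr0.
  rewrite (negPf (_ : m *+ l + (n + m *+ j) != 0)) ?mul0r ?scale0r ?addr0.
    by rewrite d2 intrM addrCA -mulrnDr addnC.
  apply: contraNneq nm => e.
  have := congr1 (det2^~ m) e.
  by rewrite !det2Dl !det2Ml det2mm !mulr0 addr0 add0r det20m => ->.
Qed.

End Line.

(* On the boundary [i = r * J] the bracket of the two generators may vanish. *)
Lemma cone_vanishes m n J v : det2 n m != 0 ->
  (forall b j, (J <= j)%N -> X b (n + m *+ j) v = 0) ->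
  forall b r i, (0 < r)%N -> (r * J < i)%N -> X b (n *+ r + m *+ i) v = 0.
Proof.
move=> nm Xv b; elim=> // r IH i _; have [->|r0] := posnP r.
  by rewrite mul1n mulr1n => /ltnW; apply: Xv.
move=> ltJi; have ltJi' : (r * J < i - J)%N by lia.
(* The target is [p] on the first line plus [q] in the cone already treated; [i - J > r * J] makes
   their determinant nonzero, so the bracket reaches the target. *)
pose p := n + m *+ J; pose q := n *+ r + m *+ (i - J).
have pq : p + q = n *+ r.+1 + m *+ i.
  by rewrite /p /q addrACA -mulrS -mulrnDr subnKC //; lia.
have := E_X_comm b p q v.
rewrite [X b q v]IH // [X false p v]Xv // !(linear_op0 (lin_X _ _)) add0r pq.
have dq : det2 q p = ((r * J)%N%:Z - (i - J)%N%:Z) * det2 n m.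
  rewrite /p /q !det2Dl !det2Dr !det2Ml !det2Mr !det2mm [det2 m n]det2C PoszM; ring.
have -> : (n *+ r.+1 + m *+ i == 0) = false.
  apply: contraNF nm => /eqP e; have := congr1 (det2^~ m) e.
  rewrite det2Dl !det2Ml det2mm mulr0 addr0 det20m => /eqP.
  by rewrite mulf_eq0.
rewrite mul0r scale0r addr0 => /esym/eqP; rewrite scaler_eq0 intr_eq0 dq mulf_eq0.
rewrite (negPf nm) orbF => /orP[|/eqP //]; lia.
Qed.

(** * Construction of the generating vector *)

Hypothesis irr : irreducible_module act.
Hypothesis wV : exists lam v, weight_vector lam v /\ v != 0.
Hypothesis fdV : forall lam, finite_dim (weight_vector lam).

Let ghw_generator : Prop := exists b1 b2 : Gamma, is_Zbasis b1 b2 /\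
  exists v, [/\ v != 0, exists lam, weight_vector lam v,
    forall w, env_orbit act v w &
    forall p q : nat, act (E (b1 *+ p + b2 *+ q)) v = 0 /\
                      act (t (b1 *+ p + b2 *+ q)) v = 0].

(** Both families kill [w] at [n + j m'] beyond a common threshold, hence on a whole cone, and a
    basis of Gamma can be chosen inside that cone. *)
Lemma GHW_of_line m n b : level b m != 0 -> (b -> level false m = 0) ->
  det2 n m * det2 n m = 1 -> ghw_generator.
Proof.
move=> lev0 levf nm.
have m0 : m != 0.
  by apply: contra_eqN nm => /eqP ->; rewrite det2m0 mul0r eq_sym oner_eq0.
have [lam [v [wv v0]]] := wV.
have [mu [s [w [N [hs ww w0 Ew]]]]] := annihilated_on_half_line m0 lev0 levf fdV wv v0.
pose m' := m *~ s.
have ss : s * s = 1 by case: hs => ->.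
have s0 : s != 0 by case: hs => ->.
have m'0 : m' != 0 by rewrite Gamma_mulz_eq0.
have lev0' : level b m' != 0 by rewrite levelZ mulf_neq0 // intr_eq0.
have nm' : det2 n m' * det2 n m' = 1.
  rewrite -[RHS](mulr1 1) -{1}nm -ss /m' /det2 Gamma_mulz /=; ring.
have nm'0 : det2 n m' != 0.
  by apply: contra_eqN nm' => /eqP ->; rewrite mul0r eq_sym oner_eq0.
have van b' := adjacent_line_vanishes m'0 lev0' b' fdV ww nm'0 Ew.
have [Jt HJt] := van true; have [JE HJE] := van false.
have Xw b' j : (maxn Jt JE <= j)%N -> X b' (n + m' *+ j) w = 0.
  by rewrite geq_max => /andP[jt jE]; case: b'; [exact: HJt | exact: HJE].
have cone := cone_vanishes nm'0 Xw.
set J := maxn Jt JE in cone.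
(* Consecutive coefficients of [m'] keep the determinant of [n] and [m']. Combinations are
   [(p + q) n + i m'] with [i > (p + q) J], unless [p = q = 0], where E(0) = t^0 = 0 applies. *)
exists (n + m' *+ J.+1), (n + m' *+ J.+2); split.
  apply: (det2_is_Zbasis (erefl _)); rewrite -[RHS]nm'.
  have det_ij i j : det2 (n + m' *+ i) (n + m' *+ j) = (j%:Z - i%:Z) * det2 n m'.
    by rewrite !det2Dl !det2Dr !det2Ml !det2Mr !det2mm [det2 m' n]det2C; ring.
  by rewrite det_ij (_ : _ - _ = 1) ?mul1r //; lia.
exists w; split=> //; first by exists mu.
  by move=> u; apply: env_orbit_full => //; apply: actDr lieV.
move=> p q; suff Xpq b' : X b' ((n + m' *+ J.+1) *+ p + (n + m' *+ J.+2) *+ q) w = 0.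
  by split; [exact: (Xpq false) | exact: (Xpq true)].
have comb i j : (n + m' *+ i) *+ p + (n + m' *+ j) *+ q =
    n *+ (p + q) + m' *+ (i * p + j * q).
  by rewrite !mulrnDl -!mulrnA !mulrnDr addrACA.
rewrite comb.
have [pq0|pq0] := posnP (p + q)%N; last by apply: cone => //; nia.
have [-> ->] : p = 0%N /\ q = 0%N by lia.
by rewrite !muln0 !mulr0n addr0 X0.
Qed.

Lemma nonzero_level_generator : c != 0 -> ghw_generator.
Proof.
move=> c0.
pose e1 : Gamma := (1, 0); pose e2 : Gamma := (0, 1).
have d12 : det2 e1 e2 * det2 e1 e2 = 1 by [].
have d21 : det2 e2 e1 * det2 e2 e1 = 1 by [].
have lev_e1 b : level b e1 = c 0 (if b then @Ordinal 4 0 isT else @Ordinal 4 2 isT).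
  by rewrite /level; case: b; rewrite [_.1]/(1 : int) [_.2]/(0 : int) mul1r mul0r addr0.
have lev_e2 b : level b e2 = c 0 (if b then @Ordinal 4 1 isT else @Ordinal 4 3 isT).
  by rewrite /level; case: b; rewrite [_.1]/(0 : int) [_.2]/(1 : int) mul1r mul0r add0r.
(* The four scalars are the levels at [e1] and [e2]. X = t is tried only once both levels of E
   vanish, as its use requires. *)
have [f1|f1] := eqVneq (level false e1) 0; last by apply: (GHW_of_line f1 _ d21).
have [f2|f2] := eqVneq (level false e2) 0; last by apply: (GHW_of_line f2 _ d12).
have [h1|h1] := eqVneq (level true e1) 0; last by apply: (GHW_of_line h1 _ d21).
have [h2|h2] := eqVneq (level true e2) 0; last by apply: (GHW_of_line h2 _ d12).
case/eqP: c0; apply/rowP => i; rewrite mxE.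
case: i => [[|[|[|[|//]]]] lt_i4]; [move: h1|move: h2|move: f1|move: f2];
  rewrite ?lev_e1 ?lev_e2 => <-; congr (c _ _); exact: val_inj.
Qed.

End ToroidalModule.

(** * Application to the concrete algebra over the complex numbers *)

Theorem theorem3p1 (R : realType) (V : lmodType R[i])
    (act : Ltilde R[i] -> V -> V) (c : 'rV[R[i]]_4) :
  is_lie_module (@Lbr R[i]) act ->
  Harish_Chandra_module act ->
  (forall (i : 'I_4) (v : V), act (K_ R[i] i) v = c 0 i *: v) ->
  c != 0 ->
  GHW_module act.
Proof.
move=> lieV [irr wV fdV] actK c0; split=> //.
apply: (nonzero_level_generator (@t_0 R[i]) (@E_0 R[i]) (@LbrC R[i])
  (@Lbr_tt R[i]) (@Lbr_tE R[i]) (@Lbr_EE R[i]) (@Lbr_dt R[i]) (@Lbr_dE R[i])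
  (@Lbr_Kl R[i]) lieV actK irr _ fdV c0).
have [[v v0] _] := irr; have [/(_ v) [s [w [_ ww vE]]] _] := wV.
apply: contrapT => nex; move: v0; rewrite vE big1 ?eqxx // => lam _.
by apply/eqP/negPn/negP => wl0; apply: nex; exists lam, (w lam); split=> //; exact: ww.
Qed.
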